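(* Let $U_8^4=\{L(C)\in TLeib_8 : c_{3,4}\neq 0,\ c_{1,1}=c_{0,1}=c_{1,2}=0,\ c_{1,3}\neq 0,\ c_{1,4}\neq 0\}$. 1. Two algebras $L(C)$ and $L(C')$ from $U_8^4$ are isomorphic if and only if $\frac{{c'}_{1,3}^{11}c'_{0,0}}{{c'}_{1,4}^{9}c'_{3,4}}=\frac{c_{1,3}^{11}c_{0,0}}{c_{1,4}^9c_{3,4}}$. 2. For any $\lambda\in\mathbb{C}$ there exists $L(C)\in U_8^4$ with $\frac{c_{1,3}^{11}c_{0,0}}{c_{1,4}^9c_{3,4}}=\lambda$. Moreover, the orbits (isomorphism classes) in $U_8^4$ are parameterized by the algebras $L(\lambda,0,0,0,1,1,0,0,0,1)$, $\lambda\in\mathbb{C}$: these algebras lie in $U_8^4$ and every algebra in $U_8^4$ is isomorphic to one of them.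
   Context: All algebras are over $\mathbb{C}$. For $C=(c_{0,0},c_{0,1},c_{1,1},c_{1,2},c_{1,3},c_{1,4},c_{1,5},c_{2,3},c_{2,4},c_{3,4})\in\mathbb{C}^{10}$, $L(C)$ denotes the $8$-dimensional complex algebra with basis $e_0,\dots,e_7$ and products (products of basis vectors not listed are zero): $[e_i,e_0]=e_{i+1}$ for $1\le i\le 6$; $[e_0,e_i]=-e_{i+1}$ for $2\le i\le 6$; $[e_0,e_0]=c_{0,0}e_7$; $[e_0,e_1]=-e_2+c_{0,1}e_7$; $[e_1,e_1]=c_{1,1}e_7$; $[e_1,e_2]=-[e_2,e_1]=c_{1,2}e_4+c_{1,3}e_5+c_{1,4}e_6+c_{1,5}e_7$; $[e_1,e_3]=-[e_3,e_1]=c_{1,2}e_5+c_{1,3}e_6+c_{1,4}e_7$; $[e_1,e_4]=-[e_4,e_1]=(c_{1,2}-c_{2,3})e_6+(c_{1,3}-c_{2,4})e_7$; $[e_1,e_5]=-[e_5,e_1]=(c_{1,2}-2c_{2,3})e_7$; $[e_2,e_3]=-[e_3,e_2]=c_{2,3}e_6+c_{2,4}e_7$; $[e_2,e_4]=-[e_4,e_2]=c_{2,3}e_7$; $[e_i,e_{7-i}]=-[e_{7-i},e_i]=(-1)^ic_{3,4}e_7$ for $1\le i\le 6$. $TLeib_8$ is the set of all $L(C)$ with $c_{3,4}(c_{2,3}+2c_{1,2})=0$ (the condition for $L(C)$ to be a Leibniz algebra, i.e. to satisfy $[x,[y,z]]=[[x,y],z]-[[x,z],y]$). The entries of $C'$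 are denoted $c'_{i,j}$, in the same order. ''Isomorphic'' means isomorphic as algebras over $\mathbb{C}$; an orbit is an isomorphism class. *)

(* Defs.v *)
From HB Require Import structures.
From mathcomp Require Import all_boot all_order all_algebra.
From mathcomp Require Import reals complex.

Set Implicit Arguments.
Unset Strict Implicit.
Unset Printing Implicit Defensive.

Import GRing.Theory.
Local Open Scope ring_scope.

Record params (K : Type) := Params {
  c00 : K; c01 : K; c11 : K; c12 : K; c13 : K;
  c14 : K; c15 : K; c23 : K; c24 : K; c34 : K }.

(* [e k] is meant for [k < 8] only: [inord] sends larger [k] to [0]. *)
Definition e (K : fieldType) (k : nat) : 'rV[K]_8 := delta_mx 0 (inord k).
Arguments e {K} k.

(* [e_i, e_j] for 1 <= i < j *)
Definition L_upper (K : fieldType) (C : params K) (i j : nat) : 'rV[K]_8 :=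
  match i, j with
  | 1, 2 => c12 C *: e 4 + c13 C *: e 5 + c14 C *: e 6 + c15 C *: e 7
  | 1, 3 => c12 C *: e 5 + c13 C *: e 6 + c14 C *: e 7
  | 1, 4 => (c12 C - c23 C) *: e 6 + (c13 C - c24 C) *: e 7
  | 1, 5 => (c12 C - 2 * c23 C) *: e 7
  | 2, 3 => c23 C *: e 6 + c24 C *: e 7
  | 2, 4 => c23 C *: e 7
  | _, _ => if (i + j == 7)%N then ((-1) ^+ i * c34 C) *: e 7 else 0
  end.

(* [e_i, e_j] for 0 <= i, j <= 7 *)
Definition L_basis (K : fieldType) (C : params K) (i j : nat) : 'rV[K]_8 :=
  match i, j with
  | 0, 0 => c00 C *: e 7
  | 0, 1 => - e 2 + c01 C *: e 7
  | 0, _ => if (j <= 6)%N then - e j.+1 else 0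
  | _, 0 => if (i <= 6)%N then e i.+1 else 0
  | 1, 1 => c11 C *: e 7
  | _, _ => if (i < j)%N then L_upper C i j
            else if (j < i)%N then - L_upper C j i
            else 0
  end.

Definition L (K : fieldType) (C : params K) (x y : 'rV[K]_8) : 'rV[K]_8 :=
  \sum_(i < 8) \sum_(j < 8) (x 0 i * y 0 j) *: L_basis C i j.

Definition isomorphic (K : fieldType) (V W : lmodType K)
    (mulV : V -> V -> V) (mulW : W -> W -> W) : Prop :=
  exists2 f : {linear V -> W},
    bijective f & forall x y, f (mulV x y) = mulW (f x) (f y).

(* [L] is injective in [C] (the parameters are structure constants), so sets
   of algebras [L C] are given as predicates on [C]. *)
Definition TLeib8 (K : fieldType) (C : params K) : Prop :=
  c34 C * (c23 C + 2 * c12 C) = 0.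

Definition U84 (K : fieldType) (C : params K) : Prop :=
  [/\ TLeib8 C, c34 C != 0,
      [/\ c11 C = 0, c01 C = 0 & c12 C = 0],
      c13 C != 0 & c14 C != 0].

(* Main.v *)
Require Import Defs.
From HB Require Import structures.
From mathcomp Require Import all_boot all_order all_algebra.
From mathcomp Require Import reals complex ring.

Set Implicit Arguments.
Unset Strict Implicit.
Unset Printing Implicit Defensive.

Import GRing.Theory.
Local Open Scope ring_scope.

(** Every member of U84 has c23 = 0, because c34 is nonzero and c12 = 0; so
    U84 lies in the family [reduced a b c d f g] whose only free parameters are
    c00, c13, c14, c15, c24, c34.

    Normal form.  These algebras are generated by e_0 and e_1, so an isomorphism
    is a choice of new generators E_0, E_1, the other basis vectors being
    E_(i+1) = [E_i, E_0].  Three changes of generators suffice.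
    Taking E_0 = e_0 + t e_1 divides c34 and c00 by u = 1 + t c34 and leaves
    c13 and c14 alone ([reduced_shift]).  Taking E_1 = e_1 + p e_3 + q e_5
    translates c24 by 2 p c34 and, once p is chosen, q translates c15 by
    - 2 q c34, so both can be made 0 ([reduced_adjust]); this is where 2 has to
    be invertible.  Rescaling E_0 = s e_0, E_1 = r e_1 multiplies c13, c14, c34
    by r/s^3, r/s^4, r/s ([reduced_scale]); s = c14/c13 and r = s^3/c13 make the first two equal
    to 1, and u = c34 c14^2 / c13^3 in the first step makes the third equal
    to 1.  No root extraction occurs, and what is left of c00 is
    [lambda C] = c13^11 c00 / (c14^9 c34) ([U84_normal_form]).

    Invariance.  Conversely let an isomorphism be given and let E_i be the image
    of e_i.  From E_(i+1) = [E_i, E_0] one sees that E_i has no component on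
    e_0, ..., e_(i-1) when i >= 2.  With A, B, t, h the coefficients of
    E_0 on e_0, of E_1 on e_1, of E_0 on e_1 and of E_1 on e_0, the
    coefficient of E_i on e_i is (B A - h t) A^(i-2) for 2 <= i <= 6, and
    (B A - h t) A^4 u with u = A + t c34 for i = 7.  Since E_7 is nonzero, none
    of these factors vanishes.  In [E_1, E_2] there is no e_3, which forces
    h = 0, and comparing the leading coefficients of [E_1, E_2], [E_2, E_5] and
    [E_0, E_0] shows that c13, c14, c34, c00 change as they do under the three
    substitutions above ([reduced_transport]).  The exponents in [lambda] are
    those for which A, B and u cancel. *)

Local Notation "x @[ k ]" := (x 0 (inord k))
  (at level 2, left associativity, format "x @[ k ]").

(** * Coordinates of the product *)

Lemma big_ord8 (V : nmodType) (F : 'I_8 -> V) :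
  \sum_(i < 8) F i = F (inord 0) + F (inord 1) + F (inord 2) + F (inord 3)
    + F (inord 4) + F (inord 5) + F (inord 6) + F (inord 7).
Proof.
rewrite !big_ord_recr big_ord0 /= add0r.
by do ![congr (_ + _)]; congr F; apply/val_inj; rewrite /= inordK.
Qed.

Lemma ord8_ind (P : 'I_8 -> Prop) :
  P (inord 0) -> P (inord 1) -> P (inord 2) -> P (inord 3) ->
  P (inord 4) -> P (inord 5) -> P (inord 6) -> P (inord 7) -> forall i, P i.
Proof.
move=> P0 P1 P2 P3 P4 P5 P6 P7 i; rewrite -(inord_val i).
by case: i => [[|[|[|[|[|[|[|[|m]]]]]]]] ?] //=.
Qed.

Lemma coord_e (K : fieldType) (i : 'I_1) (j k : nat) : (j < 8)%N -> (k < 8)%N ->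
  (e k : 'rV[K]_8) i (inord j) = (j == k)%:R.
Proof.
move=> j8 k8; rewrite mxE ord1 eqxx /=.
by rewrite -(inj_eq val_inj) /= !inordK.
Qed.

Lemma L_e (K : fieldType) (C : params K) (i j : nat) :
  (i < 8)%N -> (j < 8)%N -> L C (e i) (e j) = L_basis C i j.
Proof.
move=> i8 j8; rewrite /L (bigD1 (inord i)) //= (bigD1 (inord j)) //=.
rewrite !mxE !eqxx mulr1 scale1r !inordK // big1 ?addr0 => [|l /negPf lj].
  rewrite big1 ?addr0 // => l /negPf li; rewrite big1 // => m _.
  by rewrite !mxE li andbF mul0r scale0r.
by rewrite !mxE lj andbF mulr0 scale0r.
Qed.

Definition reduced (K : fieldType) (a b c d f g : K) : params K :=
  Params a 0 0 0 b c d 0 f g.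

(** The coordinates of [e_i, y], that is, row [i] of the matrix of right
    multiplication by [y].  Summing over [j] alone first keeps the case analysis over the
    64 products of basis vectors small. *)
Definition basis_mul_coord (K : fieldType) (a b c d f g : K)
    (y : 'rV[K]_8) (i : nat) : seq K :=
  match i with
  | 0 => [:: 0; 0; - y@[1]; - y@[2]; - y@[3]; - y@[4]; - y@[5];
             a * y@[0] - y@[6]]
  | 1 => [:: 0; 0; y@[0]; 0; 0; b * y@[2]; b * y@[3] + c * y@[2];
             d * y@[2] + c * y@[3] + (b - f) * y@[4] - g * y@[6]]
  | 2 => [:: 0; 0; 0; y@[0]; 0; - (b * y@[1]); - (c * y@[1]);
             - (d * y@[1]) + f * y@[3] + g * y@[5]]
  | 3 => [:: 0; 0; 0; 0; y@[0]; 0; - (b * y@[1]);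
             - (c * y@[1]) - f * y@[2] - g * y@[4]]
  | 4 => [:: 0; 0; 0; 0; 0; y@[0]; 0; - ((b - f) * y@[1]) + g * y@[3]]
  | 5 => [:: 0; 0; 0; 0; 0; 0; y@[0]; - (g * y@[2])]
  | 6 => [:: 0; 0; 0; 0; 0; 0; 0; y@[0] + g * y@[1]]
  | _ => [::]
  end.

Lemma basis_mulE (K : fieldType) (a b c d f g : K) (y : 'rV[K]_8) (i : 'I_8) :
  \sum_(j < 8) y 0 j *: L_basis (reduced a b c d f g) i j
  = \row_k nth 0 (basis_mul_coord a b c d f g y i) k.
Proof.
rewrite big_ord8; apply/rowP => k; rewrite [RHS]mxE.
have addE (u v : 'rV[K]_8) n : (u + v) 0 n = u 0 n + v 0 n by rewrite mxE.
have oppE (u : 'rV[K]_8) n : (- u) 0 n = - u 0 n by rewrite mxE.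
have scaleE (s : K) (u : 'rV[K]_8) n : (s *: u) 0 n = s * u 0 n by rewrite mxE.
have zeroE n : (0 : 'rV[K]_8) 0 n = 0 by rewrite mxE.
rewrite !(addE, scaleE) !inordK //.
elim/ord8_ind: i; rewrite inordK // /L_basis /L_upper /=;
  rewrite ?(addE, oppE, scaleE, zeroE);
  elim/ord8_ind: k; rewrite ?coord_e //= inordK //=; ring.
Qed.

Lemma L_reduced_sum (K : fieldType) (a b c d f g : K) (x y : 'rV[K]_8) (k : 'I_8) :
  L (reduced a b c d f g) x y 0 k
  = \sum_(i < 8) x 0 i * nth 0 (basis_mul_coord a b c d f g y i) k.
Proof.
rewrite /L summxE; apply: eq_bigr => i _.
under eq_bigr => j _ do rewrite -scalerA.
by rewrite -scaler_sumr basis_mulE !mxE.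
Qed.

Definition minor (K : fieldType) (x y : 'rV[K]_8) (i j : nat) : K :=
  x@[i] * y@[j] - x@[j] * y@[i].
Arguments minor {K} x y i j /.

(** All parameters but [a] = c00 enter through the minors of [x] and [y], as the
    product is alternating up to the square of [e_0]. *)
Definition reduced_coord (K : fieldType) (a b c d f g : K) (x y : 'rV[K]_8) :=
  [:: 0; 0; minor x y 1 0; minor x y 2 0; minor x y 3 0;
      minor x y 4 0 + b * minor x y 1 2;
      minor x y 5 0 + b * minor x y 1 3 + c * minor x y 1 2;
      minor x y 6 0 + a * (x@[0] * y@[0]) + d * minor x y 1 2
        + c * minor x y 1 3 + (b - f) * minor x y 1 4 + f * minor x y 2 3
        - g * (minor x y 1 6 - minor x y 2 5 + minor x y 3 4)].

Lemma L_reducedE (K : fieldType) (a b c d f g : K) (x y : 'rV[K]_8) (k : 'I_8) :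
  L (reduced a b c d f g) x y 0 k
  = nth 0 (reduced_coord a b c d f g x y) k.
Proof.
rewrite L_reduced_sum big_ord8 !inordK //=.
elim/ord8_ind: k; rewrite inordK //=; ring.
Qed.

(** * Isomorphisms from changes of basis *)

Lemma isomorphic_sym (K : fieldType) (V W : lmodType K)
    (mulV : V -> V -> V) (mulW : W -> W -> W) :
  isomorphic mulV mulW -> isomorphic mulW mulV.
Proof.
case=> f [g fK gK] f_mul.
pose g_lin := GRing.isLinear.Build K W V *:%R g (GRing.can2_linear fK gK).
exists (HB.pack_for {linear W -> V} g g_lin); first by exists f.
by move=> x y /=; rewrite -{1}[x]gK -{1}[y]gK -f_mul fK.
Qed.

Lemma isomorphic_trans (K : fieldType) (U V W : lmodType K)
    (mulU : U -> U -> U) (mulV : V -> V -> V) (mulW : W -> W -> W) :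
  isomorphic mulU mulV -> isomorphic mulV mulW -> isomorphic mulU mulW.
Proof.
move=> [f f_bij f_mul] [g g_bij g_mul]; exists (g \o f).
  exact: bij_comp.
by move=> x y /=; rewrite f_mul g_mul.
Qed.

(** Missing entries at the end of a row are read as 0. *)
Definition frame (K : fieldType) (rows : seq (seq K)) : 'M[K]_8 :=
  \matrix_(i, j) nth 0 (nth [::] rows i) j.

(** An upper triangular frame in [L C] with nonzero diagonal is a basis; if it
    multiplies like the basis of [L C'], the two algebras are isomorphic. *)
Lemma isomorphic_frame (K : fieldType) (C C' : params K)
    (rows : seq (seq K)) :
  let M := frame rows in
  (forall i j : 'I_8, (j < i)%N -> M i j = 0) ->
  (forall i, M i i != 0) ->
  (forall x y, L C' x y *m M = L C (x *m M) (y *m M)) ->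
  isomorphic (L C) (L C').
Proof.
move=> M upM diagM M_mul; apply: isomorphic_sym.
have M_unit : M \in unitmx.
  rewrite -unitmx_tr unitmxE det_trig; last first.
    by apply/is_trig_mxP => i j ij; rewrite mxE upM.
  by rewrite unitfE; apply/prodf_neq0 => i _; rewrite mxE.
exists (mulmxr M) => //=.
by exists (mulmxr (invmx M)) => x /=; rewrite (mulmxK, mulmxKV).
Qed.

Lemma mul_frame (K : fieldType) (rows : seq (seq K)) (x : 'rV[K]_8) k :
  (k < 8)%N ->
  (x *m frame rows)@[k] =
    let m i := x@[i] * nth 0 (nth [::] rows i) k in
    m 0%N + m 1%N + m 2%N + m 3%N + m 4%N + m 5%N + m 6%N + m 7%N.
Proof. by move=> k8; rewrite mxE big_ord8 !mxE !inordK. Qed.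

(** * Changes of generators *)

(** The change of generators E_0 = e_0 + t e_1, E_1 = e_1; the rows below are the
    iterated products E_(i+1) = [E_i, E_0].  The factor [u] on e_7 appears because
    [e_6, e_1] = g e_7 adds to [e_6, e_0] = e_7, and it is what rescales [g]. *)
Lemma reduced_shift (K : fieldType) (a b c d f g t : K) :
  let u := 1 + t * g in u != 0 ->
  isomorphic (L (reduced a b c d f g))
    (L (reduced (a / u) b c
         ((d + t * b * (3 * b - f + 2 * t * b * g)) / u)
         ((f - t * b * g) / u) (g / u))).
Proof.
move=> u u0; apply: (@isomorphic_frame _ _ _
  [:: [:: 1; t];
      [:: 0; 1];
      [:: 0; 0; 1];
      [:: 0; 0; 0; 1; 0; - (t * b); - (t * c); - (t * d)];
      [:: 0; 0; 0; 0; 1; 0; - (2 * t * b); - (2 * t * c + t ^+ 2 * c * g)];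
      [:: 0; 0; 0; 0; 0; 1; 0; - t * (3 * b - f + 2 * t * b * g)];
      [:: 0; 0; 0; 0; 0; 0; 1];
      [:: 0; 0; 0; 0; 0; 0; 0; u]]).
- by elim/ord8_ind=> j; elim/ord8_ind: j; rewrite mxE !inordK.
- by elim/ord8_ind; rewrite mxE !inordK //= oner_neq0.
move=> x y; apply/rowP; elim/ord8_ind;
  rewrite mul_frame //= !L_reducedE !inordK //= ?mul_frame //=;
  rewrite /u in u0 *; first [ring | field]; exact: u0.
Qed.

(** The change of generators E_0 = e_0, E_1 = e_1 + p e_3 + q e_5.  The translation
    of [f] comes from [e_2, e_5] and [e_4, e_3] inside [E_2, E_3], that of [d] by
    [q] from [e_1, e_6] and [e_5, e_2] inside [E_1, E_2]. *)
Lemma reduced_adjust (K : fieldType) (a b c d f g p q : K) :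
  isomorphic (L (reduced a b c d f g))
    (L (reduced a b c
         (d - 2 * p * f - p ^+ 2 * g - 2 * q * g) (f + 2 * p * g) g)).
Proof.
apply: (@isomorphic_frame _ _ _
  [:: [:: 1];
      [:: 0; 1; 0; p; 0; q];
      [:: 0; 0; 1; 0; p; 0; q];
      [:: 0; 0; 0; 1; 0; p; 0; q];
      [:: 0; 0; 0; 0; 1; 0; p];
      [:: 0; 0; 0; 0; 0; 1; 0; p];
      [:: 0; 0; 0; 0; 0; 0; 1];
      [:: 0; 0; 0; 0; 0; 0; 0; 1]]).
- by elim/ord8_ind=> j; elim/ord8_ind: j; rewrite mxE !inordK.
- by elim/ord8_ind; rewrite mxE !inordK //= oner_neq0.
move=> x y; apply/rowP; elim/ord8_ind;
  rewrite mul_frame //= !L_reducedE !inordK //= ?mul_frame //=;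
  ring.
Qed.

(** The change of generators E_0 = s e_0, E_1 = r e_1, under which e_i has weight
    s^(i-1) r for i >= 1; a parameter is multiplied by the weight of the bracket
    where it occurs and divided by the weight of the basis vector it multiplies. *)
Lemma reduced_scale (K : fieldType) (a b c d f g s r : K) :
  s != 0 -> r != 0 ->
  isomorphic (L (reduced a b c d f g))
    (L (reduced (a / (s ^+ 4 * r)) (b * r / s ^+ 3) (c * r / s ^+ 4)
         (d * r / s ^+ 5) (f * r / s ^+ 3) (g * r / s))).
Proof.
move=> s0 r0; apply: (@isomorphic_frame _ _ _
  [:: [:: s];
      [:: 0; r];
      [:: 0; 0; s * r];
      [:: 0; 0; 0; s ^+ 2 * r];
      [:: 0; 0; 0; 0; s ^+ 3 * r];
      [:: 0; 0; 0; 0; 0; s ^+ 4 * r];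
      [:: 0; 0; 0; 0; 0; 0; s ^+ 5 * r];
      [:: 0; 0; 0; 0; 0; 0; 0; s ^+ 6 * r]]).
- by elim/ord8_ind=> j; elim/ord8_ind: j; rewrite mxE !inordK.
- by elim/ord8_ind; rewrite mxE !inordK //= ?mulf_neq0 ?expf_neq0.
move=> x y; apply/rowP; elim/ord8_ind;
  rewrite mul_frame //= !L_reducedE !inordK //= ?mul_frame //=;
  first [ring | field; by rewrite ?s0 ?r0].
Qed.

(** * Normal forms *)

Definition lambda (K : fieldType) (C : params K) : K :=
  c13 C ^+ 11 * c00 C / (c14 C ^+ 9 * c34 C).

Lemma U84_reduced (K : fieldType) (C : params K) : U84 C ->
  C = reduced (c00 C) (c13 C) (c14 C) (c15 C) (c24 C) (c34 C).
Proof.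
case: C => a c01 c11 c12 b c d c23 f g [/= leib g0 [/= -> -> c12_0] _ _].
move: leib; rewrite /TLeib8 /= c12_0 mulr0 addr0 => /eqP.
by rewrite mulf_eq0 (negPf g0) /= => /eqP ->.
Qed.

Lemma U84_normal_form (K : fieldType) (C : params K) :
  2 != 0 :> K -> U84 C ->
  isomorphic (L C) (L (reduced (lambda C) 1 1 0 0 1)).
Proof.
move=> two0 UC; case: (UC) => _ g0 _ b0 c0; rewrite {1}(U84_reduced UC).
rewrite /lambda; move: (c00 C) (c13 C) (c14 C) (c15 C) (c24 C) (c34 C) b0 c0 g0.
move=> {C UC} a b c d f g b0 c0 g0.
(* The value of [u] for which the final scaling brings [g / u] to 1. *)
pose u := g * c ^+ 2 / b ^+ 3; pose t := (u - 1) / g.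
have uE : 1 + t * g = u by rewrite /t divfK // addrC subrK.
have u0 : u != 0 by rewrite !(mulf_neq0, expf_neq0, invr_neq0).
have shift := @reduced_shift _ a b c d f g t; rewrite /= uE in shift.
apply: isomorphic_trans (shift u0) _ => {shift}.
set d1 := (X in reduced _ _ _ X _ _).
set f1 := (X in reduced _ _ _ _ X _).
have g1E : g / u = b ^+ 3 / c ^+ 2 by rewrite /u; field; rewrite b0 c0 g0.
rewrite g1E; set g1 := b ^+ 3 / c ^+ 2.
have g10 : g1 != 0 by rewrite !(mulf_neq0, expf_neq0, invr_neq0).
pose p := - f1 / (2 * g1); pose q := (d1 - 2 * p * f1 - p ^+ 2 * g1) / (2 * g1).
apply: isomorphic_trans (reduced_adjust _ _ _ _ _ _ p q) _.
have -> : f1 + 2 * p * g1 = 0 by rewrite /p; field; rewrite two0 g10.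
have -> : d1 - 2 * p * f1 - p ^+ 2 * g1 - 2 * q * g1 = 0.
  by rewrite /q; field; rewrite two0 g10.
have s0 : c / b != 0 by rewrite mulf_neq0 ?invr_neq0.
have r0 : c ^+ 3 / b ^+ 4 != 0 by rewrite mulf_neq0 ?invr_neq0 ?expf_neq0.
have := reduced_scale (a / u) b c 0 0 g1 s0 r0.
have -> : a / u / ((c / b) ^+ 4 * (c ^+ 3 / b ^+ 4))
          = b ^+ 11 * a / (c ^+ 9 * g).
  by rewrite /u; field; rewrite b0 c0 g0.
have -> : b * (c ^+ 3 / b ^+ 4) / (c / b) ^+ 3 = 1 by field; rewrite b0 c0.
have -> : c * (c ^+ 3 / b ^+ 4) / (c / b) ^+ 4 = 1 by field; rewrite b0 c0.
have -> : g1 * (c ^+ 3 / b ^+ 4) / (c / b) = 1.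
  by rewrite /g1; field; rewrite b0 c0.
by rewrite !mul0r.
Qed.

(** * Invariance of lambda *)

(** An isomorphism takes e_0 to A e_0 + ... and e_1 to B e_1 + ..., and [u] is
    the extra scalar on e_7 already met in [reduced_shift]. *)
Lemma reduced_transport (K : fieldType) (a b c d f g a' b' c' d' f' g' : K) :
  isomorphic (L (reduced a b c d f g)) (L (reduced a' b' c' d' f' g')) ->
  exists A B u : K, [/\ A != 0, B != 0 & u != 0] /\
    [/\ a = a' / (B * A ^+ 3 * u), b = b' * B / A ^+ 3,
        c = c' * B / A ^+ 4 & g = g' * B / u].
Proof.
move=> [F F_bij F_mul].
pose E i := F (e i).
have E_mul i j : (i < 8)%N -> (j < 8)%N ->
    F (L_basis (reduced a b c d f g) i j)
    = L (reduced a' b' c' d' f' g') (E i) (E j).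
  by move=> i8 j8; rewrite -L_e // F_mul.
have succE i : (0 < i < 7)%N ->
    E i.+1 = L (reduced a' b' c' d' f' g') (E i) (E 0).
  case/andP=> i0 i7; rewrite -E_mul //; last exact: ltnW.
  by case: i i0 i7 => [|[|[|[|[|[|[|]]]]]]].
have coord_succ i k : (0 < i < 7)%N -> (k < 8)%N ->
    (E i.+1)@[k] = nth 0 (reduced_coord a' b' c' d' f' g' (E i) (E 0)) k.
  by move=> i7 k8; rewrite succE // L_reducedE inordK.
(* For i >= 2, E_i has no component on e_k with k < i: bracketing with E_0 raises
   the index. *)
have E2_0 : (E 2)@[0] = 0 by rewrite coord_succ.
have E2_1 : (E 2)@[1] = 0 by rewrite coord_succ.
have z3 : [/\ (E 3)@[0] = 0, (E 3)@[1] = 0 & (E 3)@[2] = 0].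
  by split; rewrite coord_succ //= ?E2_0 ?E2_1; ring.
case: z3 => E3_0 E3_1 E3_2.
have z4 : [/\ (E 4)@[0] = 0, (E 4)@[1] = 0, (E 4)@[2] = 0 & (E 4)@[3] = 0].
  by split; rewrite coord_succ //= ?E3_0 ?E3_1 ?E3_2; ring.
case: z4 => E4_0 E4_1 E4_2 E4_3.
have z5 : [/\ (E 5)@[0] = 0, (E 5)@[1] = 0, (E 5)@[2] = 0, (E 5)@[3] = 0
            & (E 5)@[4] = 0].
  by split; rewrite coord_succ //= ?E4_0 ?E4_1 ?E4_2 ?E4_3; ring.
case: z5 => E5_0 E5_1 E5_2 E5_3 E5_4.
have z6 k : (k < 6)%N -> (E 6)@[k] = 0.
  by do 6![case: k => [_|k]; first by
     rewrite coord_succ //= ?E5_0 ?E5_1 ?E5_2 ?E5_3 ?E5_4; ring].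
have z7 k : (k < 7)%N -> (E 7)@[k] = 0.
  by do 7![case: k => [_|k]; first by rewrite coord_succ //= ?z6 //; ring].
(* [h] has to be carried along: that it is 0 is deduced below from D != 0. *)
set A := (E 0)@[0]; set t := (E 0)@[1]; set h := (E 1)@[0].
set B := (E 1)@[1]; set m := (E 1)@[2].
pose D := B * A - h * t; pose u := A + g' * t.
have E2_2 : (E 2)@[2] = D by rewrite coord_succ.
have E3_3 : (E 3)@[3] = D * A.
  by rewrite coord_succ //= E2_0 E2_2 -/A; ring.
have E4_4 : (E 4)@[4] = D * A ^+ 2.
  by rewrite coord_succ //= E3_0 E3_3 -/A; ring.
have E5_5 : (E 5)@[5] = D * A ^+ 3.
  by rewrite coord_succ //= E4_0 E4_1 E4_2 E4_4 -/A; ring.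
have E6_6 : (E 6)@[6] = D * A ^+ 4.
  by rewrite coord_succ //= E5_0 E5_1 E5_2 E5_3 E5_5 -/A; ring.
have E7_7 : (E 7)@[7] = D * A ^+ 4 * u.
  by rewrite coord_succ //= E6_6 !z6 // -/A -/t /u; ring.
have : (E 7)@[7] != 0.
  apply/eqP => E7_0; have : E 7 = 0.
    by apply/rowP; elim/ord8_ind; rewrite [RHS]mxE ?E7_0 ?z7.
  rewrite /E -(linear0 F) => /(bij_inj F_bij).
  move/(congr1 (fun x : 'rV[K]_8 => x@[7]))/eqP.
  by rewrite coord_e // mxE oner_eq0.
rewrite E7_7 2!mulf_eq0 expf_eq0 /= !negb_or => /andP[/andP[D0 A0] u0].
have E00 := E_mul 0 0 isT isT.
have E12 := E_mul 1 2 isT isT.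
have E25 := E_mul 2 5 isT isT.
rewrite /L_basis /L_upper /= in E00 E12 E25.
rewrite !(linearD, linearZ) /= -/(E 7) -?/(E 5) -?/(E 6) in E00 E12 E25.
have coordD (v w : 'rV[K]_8) k : (v + w) 0 k = v 0 k + w 0 k by rewrite mxE.
have coordZ (r : K) (v : 'rV[K]_8) k : (r *: v) 0 k = r * v 0 k by rewrite mxE.
move: E00 E12 E25; rewrite scale0r add0r => /rowP E00 /rowP E12 /rowP E25.
(* The coefficient of [E_1, E_2] on e_3 is - h D, and it vanishes because E_5,
   E_6 and E_7 have no component there. *)
have h0 : h = 0.
  move: (E12 (inord 3)); rewrite !(coordD, coordZ) L_reducedE inordK //=.
  rewrite E5_3 z6 // z7 // E2_0 E2_2 -/h => /eqP.
  rewrite !mulr0 !addr0 sub0r eq_sym oppr_eq0 mulf_eq0 (negPf D0) orbF.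
  by move/eqP.
have DE : D = B * A by rewrite /D h0 mul0r subr0.
have B0 : B != 0 by move: D0; rewrite DE mulf_eq0 negb_or => /andP[].
(* Comparing [E_1, E_2] on e_6 also needs the next coefficients of the E_i; the
   contribution of [m] turns out to be the same on both sides. *)
have E2_3 : (E 2)@[3] = m * A by rewrite coord_succ //= -/h h0 mul0r subr0.
have E3_4 : (E 3)@[4] = m * A ^+ 2.
  by rewrite coord_succ //= E2_0 E2_3 -/A; ring.
have E4_5 : (E 4)@[5] = m * A ^+ 3.
  by rewrite coord_succ //= E3_0 E3_1 E3_2 E3_4 -/A; ring.
have E5_6 : (E 5)@[6] = m * A ^+ 4.
  by rewrite coord_succ //= E4_0 E4_1 E4_2 E4_3 E4_5 -/A; ring.
have bE : b = b' * B / A ^+ 3.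
  move: (E12 (inord 5)); rewrite !(coordD, coordZ) L_reducedE inordK //=.
  rewrite E5_5 z6 // z7 // E2_0 E2_1 E2_2 -/h -/B h0 => e5.
  by apply: (mulfI D0); transitivity (b * (D * A ^+ 3) / A ^+ 3);
    [|move: e5; rewrite !mulr0 !mul0r !addr0 => ->]; field.
have cE : c = c' * B / A ^+ 4.
  move: (E12 (inord 6)); rewrite !(coordD, coordZ) L_reducedE inordK //=.
  rewrite E5_6 E6_6 z7 // E2_0 E2_1 E2_2 E2_3 -/h -/B -/m h0 bE => e6.
  apply: (mulfI D0).
  transitivity ((b' * B / A ^+ 3 * (m * A ^+ 4) + c * (D * A ^+ 4) + d * 0
     - b' * B * m * A) / A ^+ 4); [field; exact: A0|].
  by rewrite e6; field.
have gE : g = g' * B / u.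
  move: (E25 (inord 7)); rewrite !(coordD, coordZ) L_reducedE inordK //=.
  rewrite E7_7 E2_0 E2_1 E2_2 E5_0 E5_1 E5_2 E5_3 E5_4 E5_5 DE => e7.
  have BAA0 : B * A * A ^+ 4 * u != 0 by rewrite !mulf_neq0 ?expf_neq0.
  apply: (mulIf BAA0).
  transitivity ((-1) ^+ 2 * g * (B * A * A ^+ 4 * u)); first by ring.
  by rewrite e7; field.
have aE : a = a' / (B * A ^+ 3 * u).
  move: (E00 (inord 7)); rewrite !(coordD, coordZ) L_reducedE inordK //=.
  rewrite E7_7 DE -/A => e7.
  have BAA0 : B * A * A ^+ 4 * u != 0 by rewrite !mulf_neq0 ?expf_neq0.
  by apply: (mulIf BAA0); rewrite e7; field; rewrite A0 B0 u0.
by exists A, B, u; split.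
Qed.

Lemma isomorphic_lambda (K : fieldType) (C C' : params K) :
  U84 C -> U84 C' -> isomorphic (L C) (L C') -> lambda C = lambda C'.
Proof.
move=> UC UC'; case: (UC') => _ g'0 _ _ c'0.
rewrite {1}(U84_reduced UC) {1}(U84_reduced UC').
case/reduced_transport=> A [B [u [[A0 B0 u0] [aE bE cE gE]]]].
rewrite /lambda aE bE cE gE; field.
by rewrite g'0 c'0 u0 A0 B0.
Qed.

(** * The classification *)

Lemma U84_representative (K : fieldType) (lam : K) :
  U84 (reduced lam 1 1 0 0 1).
Proof.
by split; rewrite ?oner_neq0 //= /TLeib8 /= mulr0 addr0 mulr0.
Qed.

Lemma lambda_representative (K : fieldType) (lam : K) :
  lambda (reduced lam 1 1 0 0 1) = lam.
Proof. by rewrite /lambda /= !expr1n !mul1r divr1. Qed.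

Theorem proposition2p17 (R : realType) :
  [/\ (forall C C' : params R[i], U84 C -> U84 C' ->
         (isomorphic (L C) (L C') <->
          c13 C' ^+ 11 * c00 C' / (c14 C' ^+ 9 * c34 C') =
          c13 C ^+ 11 * c00 C / (c14 C ^+ 9 * c34 C))),
      (forall lam : R[i], exists C : params R[i],
         U84 C /\ c13 C ^+ 11 * c00 C / (c14 C ^+ 9 * c34 C) = lam),
      (forall lam : R[i], U84 (Params lam 0 0 0 1 1 0 0 0 1)) &
      (forall C : params R[i], U84 C ->
         exists! lam : R[i],
           isomorphic (L C) (L (Params lam 0 0 0 1 1 0 0 0 1)))].
Proof.
have two0 : 2 != 0 :> R[i] by rewrite Num.Theory.pnatr_eq0.
split=> [C C' UC UC' | lam | lam | C UC].
- split=> [iso | lamE]; first by rewrite -!/(lambda _) (isomorphic_lambda UC UC').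
  apply: isomorphic_trans (U84_normal_form two0 UC) _; rewrite /lambda -lamE.
  exact: isomorphic_sym (U84_normal_form two0 UC').
- exists (reduced lam 1 1 0 0 1).
  by split; [exact: U84_representative | exact: lambda_representative].
- exact: U84_representative.
exists (lambda C); split=> [|lam iso]; first exact: U84_normal_form.
by rewrite (isomorphic_lambda UC (U84_representative lam) iso) lambda_representative.
Qed.
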